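(* Let $\Gamma=(G,\sigma)$ be an unbalanced unicyclic signed graph on $n$ vertices $1,\ldots,n$ and $n$ edges $e_1,\ldots,e_n$, with unique cycle $C$ and incidence matrix $N$. Then $N$ is invertible and, for every edge $e_i$ and vertex $j$, \[ (N^{-1})_{ij}=w(e_i)\begin{cases}\tfrac12\,\mathrm{sgn}(P_{e_i^t-j}) & \text{if } e_i\in C,\\ 0 & \text{if } e_i\notin C \text{ and } j\in G\setminus e_i[C],\\ -\mathrm{sgn}(P_{e_i-j}) & \text{if } e_i \text{ is positive}, e_i\notin E(C),\ j\notin G\setminus e_i[C] \text{ and } j\in G_h(e_i),\\ \mathrm{sgn}(P_{e_i-j}) & \text{otherwise.}\end{cases} \]
   Context: A signed graph $\Gamma=(G,\sigma)$ consists of a simple graph $G=(V,E)$, $V=\{1,\ldots,n\}$, and $\sigma:E\to\{-1,1\}$; $e$ is positive if $\sigma(e)=1$, negative if $\sigma(e)=-1$. A cycle is unbalanced if it contains an odd number of negative edges; a unicyclic signed graph is unbalanced if its unique cycle is. The sign $\mathrm{sgn}(P)$ of a path $P$ is the product of $\sigma$ over its edges (1 for the empty path). An incidence matrix of $\Gamma$ is a matrix $N=[n_{k\ell}]$ with rows indexed by vertices and columns by edges such that for each edge $e_\ell=\{i,j\}$ column $\ell$ has exactly two nonzero entries $n_{i\ell},n_{j\ell}\in\{1,-1\}$, with $n_{i\ell}=n_{j\ell}$ if $e_\ell$ is negative and $n_{i\ell}=-n_{j\ell}$ if $e_\ell$ is positive. Head/tail: a positive edge $e_\ell=\{l,m\}$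 with $n_{l\ell}=1,n_{m\ell}=-1$ has tail $l$ and head $m$; a negative edge $\{l,m\}$ with $l<m$ has tail $l$ and head $m$. $w(e_\ell)=-1$ if $e_\ell$ is negative with both nonzero entries of column $\ell$ equal to $-1$, and $w(e_\ell)=1$ otherwise. For $e_i\notin C$: $G\setminus e_i[C]$ is the connected component of $G\setminus e_i$ containing $C$, and $G_h(e_i)$ is the connected component of $G\setminus e_i$ containing the head of $e_i$; $P_{e_i-j}$ is the shortest path between vertex $j$ and edge $e_i$ not containing $e_i$. For $e_i\in C$: $e_i^t$ is the tail of $e_i$ and $P_{e_i^t-j}$ is the unique path between $e_i^t$ and $j$ in the tree $G\setminus e_i$. *)

(* Defs.v *)
From HB Require Import structures.
From mathcomp Require Import all_boot all_order all_algebra.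

Set Implicit Arguments.
Unset Strict Implicit.
Unset Printing Implicit Defensive.

Import Order.TTheory GRing.Theory Num.Theory.
Local Open Scope ring_scope.

(* Edges are two-element sets of vertices.  The values of [sign] outside
   [edges] are irrelevant. *)
Record signedGraph (n : nat) := SignedGraph {
  edges : {set {set 'I_n}};
  sign : {set 'I_n} -> int;
  edges_card2 : forall f, f \in edges -> #|f| = 2%N;
  sign_pm1 : forall f, f \in edges -> sign f = 1 \/ sign f = -1
}.

Section Graph.
Variable n : nat.
Implicit Types (E : {set {set 'I_n}}) (f : {set 'I_n}) (A : {pred 'I_n}).

Definition adj E : rel 'I_n := [rel x y | [set x; y] \in E].

Definition connected_graph E := forall x y, connect (adj E) x y.

Definition cycle_edges (c : seq 'I_n) : {set {set 'I_n}} :=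
  [set [set x; next c x] | x in c].

(* A cycle, as a subgraph, is identified with its set of edges; its vertex set
   is [cover C]. *)
Definition is_cycle E (C : {set {set 'I_n}}) :=
  exists c : seq 'I_n,
    [/\ (2 < size c)%N, ucycle (adj E) c & C = cycle_edges c].

Definition unicyclic E := connected_graph E /\ exists! C, is_cycle E C.

Definition component E A : {set 'I_n} :=
  [set y | [exists x in A, connect (adj E) x y]].

(* A path is given by its first vertex [x] and the sequence [p] of the
   following ones; it joins [x] to some vertex of [A]. *)
Definition path_to E (x : 'I_n) A (p : seq 'I_n) : bool :=
  [&& path (adj E) x p, uniq (x :: p) & last x p \in A].

(* As the vertices of a path are distinct, [p] has fewer than [n] items, so
   that paths and shortest paths can be searched for in [n.-bseq 'I_n]. *)
Definition shortest_path_to E x A (p : seq 'I_n) : bool :=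
  path_to E x A p &&
  [forall q : n.-bseq 'I_n, path_to E x A q ==> (size p <= size q)%N].

Definition the_path E x A : seq 'I_n :=
  if [pick p : n.-bseq 'I_n | path_to E x A p] is Some p
  then val p else [::].

Definition the_shortest_path E x A : seq 'I_n :=
  if [pick p : n.-bseq 'I_n | shortest_path_to E x A p] is Some p
  then val p else [::].

Definition path_edges (x : 'I_n) (p : seq 'I_n) : seq {set 'I_n} :=
  pairmap (fun u v => [set u; v]) x p.

End Graph.

Section SignedGraph.
Variables (n : nat) (G : signedGraph n).

Definition positive (f : {set 'I_n}) : bool := sign G f == 1.
Definition negative (f : {set 'I_n}) : bool := sign G f == -1.

Definition unbalanced_cycle (C : {set {set 'I_n}}) : bool :=
  odd #|[set f in C | negative f]|.

Definition unbalanced_unicyclic :=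
  unicyclic (edges G) /\ forall C, is_cycle (edges G) C -> unbalanced_cycle C.

Definition path_sign (x : 'I_n) (p : seq 'I_n) : int :=
  \prod_(f <- path_edges x p) sign G f.

Variables (m : nat) (e : 'I_m -> {set 'I_n}).

Definition edge_enumeration :=
  injective e /\ [set e l | l : 'I_m] = edges G.

Variables (R : numFieldType) (N : 'M[R]_(n, m)).

Definition incidence_matrix :=
  forall l : 'I_m,
    (forall k, k \notin e l -> N k l = 0) /\
    (forall i j, i != j -> e l = [set i; j] ->
       [/\ N i l = 1 \/ N i l = -1,
           N j l = 1 \/ N j l = -1,
           negative (e l) -> N i l = N j l &
           positive (e l) -> N i l = - N j l]).

Definition is_tail (l : 'I_m) : {pred 'I_n} :=
  [pred x | (x \in e l) &&
    (if positive (e l) then N x l == 1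
     else [forall y in e l, (x <= y)%N])].

Definition is_head (l : 'I_m) : {pred 'I_n} :=
  [pred x | (x \in e l) &&
    (if positive (e l) then N x l == -1
     else [forall y in e l, (y <= x)%N])].

Definition edge_weight (l : 'I_m) : R :=
  if negative (e l) && [forall x in e l, N x l == -1] then -1 else 1.

Definition cycle_component (C : {set {set 'I_n}}) (i : 'I_m) : {set 'I_n} :=
  component (edges G :\ e i) (mem (cover C)).

(* [G_h(e_i)] *)
Definition head_component (i : 'I_m) : {set 'I_n} :=
  component (edges G :\ e i) (is_head i).

(* Paths are undirected: both paths below are read starting from [j]. *)
Definition sgn_path_tail (i : 'I_m) (j : 'I_n) : int :=
  path_sign j (the_path (edges G :\ e i) j (is_tail i)).

Definition sgn_path_edge (i : 'I_m) (j : 'I_n) : int :=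
  path_sign j (the_shortest_path (edges G :\ e i) j (mem (e i))).

Definition inverse_entry (C : {set {set 'I_n}}) (i : 'I_m) (j : 'I_n) : R :=
  edge_weight i *
  (if e i \in C then 2^-1 * (sgn_path_tail i j)%:~R
   else if j \in cycle_component C i then 0
   else if positive (e i) && (j \in head_component i)
        then - (sgn_path_edge i j)%:~R
   else (sgn_path_edge i j)%:~R).

End SignedGraph.

(* Main.v *)
(* The matrix [M] of the claimed entries satisfies [M *m N = 1].  Column [l] of
   [N] is supported on the two ends [a], [b] of [e l], so that entry [(i, l)] of
   the product is [N a l * (M i a - sign (e l) * M i b)].  Every closed walk that
   meets no cycle has sign 1, so in [G \ e_i] signs of paths depend on their ends
   only: in the tree [G \ e_i] if [e_i] is in [C], and otherwise in the component
   of the bridge [e_i] that avoids [C].  Moving along [e l], [l != i], thus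
   multiplies row [i] of [M] by [sign (e l)], and the entry vanishes.  For
   [l = i] on [C] the two terms add up because [C] has sign -1; for a bridge only
   the end outside the component of [C] contributes. *)
Require Import Defs.
From HB Require Import structures.
From mathcomp Require Import all_boot all_order all_algebra zify.

Set Implicit Arguments.
Unset Strict Implicit.
Unset Printing Implicit Defensive.

Import Order.TTheory GRing.Theory Num.Theory.
Local Open Scope ring_scope.

(** * Walks, cycles as edge sets, and connectedness after removing an edge *)

Lemma not_uniq_split (T : eqType) (p : seq T) : ~~ uniq p ->
  exists p1 z p2 p3, p = p1 ++ z :: p2 ++ z :: p3.
Proof.
elim: p => //= x p IH; rewrite negb_and negbK => /orP [xp|/IH].
  by case/splitPr: xp => p2 p3; exists [::], x, p2, p3.
by move=> [p1 [z [p2 [p3 ->]]]]; exists (x :: p1), z, p2, p3.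
Qed.

Section Walks.
Variable n : nat.
Implicit Types (E C : {set {set 'I_n}}) (f g : {set 'I_n}) (x y z : 'I_n)
  (p q s c : seq 'I_n).

Lemma adj_sym E : symmetric (adj E).
Proof. by move=> x y; rewrite /adj /= setUC. Qed.

Lemma connect_adj_sym E : connect_sym (adj E).
Proof. exact: sym_connect_sym (adj_sym E). Qed.

Lemma path_adjE E x p : path (adj E) x p = all (mem E) (path_edges x p).
Proof. by elim: p x => //= y p IH x; rewrite IH. Qed.

Lemma mem_path_edges x p f z : f \in path_edges x p -> z \in f -> z \in x :: p.
Proof.
elim: p x => //= y p IH x; rewrite inE => /orP [/eqP ->|/IH h /h].
  by rewrite !inE => /orP [] ->; rewrite ?orbT.
by rewrite !inE => ->; rewrite orbT.
Qed.

Lemma uniq_path_edges x p : uniq (x :: p) -> uniq (path_edges x p).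
Proof.
elim: p x => //= y p IH x /andP [xN u]; rewrite IH // andbT.
apply/negP=> /mem_path_edges/(_ (set21 x y)).
by rewrite (negbTE xN).
Qed.

Lemma path_edges_rcons x p z :
  path_edges x (rcons p z) = rcons (path_edges x p) [set last x p; z].
Proof. by elim: p x => //= y p IH x; rewrite IH. Qed.

Lemma path_adj_rev E x p :
  path (adj E) (last x p) (rev (belast x p)) = path (adj E) x p.
Proof. by rewrite rev_path; apply: eq_path => u v; rewrite adj_sym. Qed.

Lemma last_rev_belast x p : last (last x p) (rev (belast x p)) = x.
Proof. by case: p => //= z p; rewrite rev_cons last_rcons. Qed.

(** Turns a cycle into a closed walk based at [x], so that facts on the edges of walks apply to
    it. *)
Lemma cycle_edgesE x s : uniq (x :: s) ->
  cycle_edges (x :: s) = [set g in path_edges x (rcons s x)].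
Proof.
move=> u.
suff -> : path_edges x (rcons s x) =
    [seq [set y; next (x :: s) y] | y <- x :: s].
  apply/setP=> g; rewrite inE; apply/imsetP/mapP => -[y ys ->]; by exists y.
apply: (@eq_from_nth _ set0); first by rewrite size_pairmap size_rcons size_map.
rewrite size_pairmap size_rcons => i ltis.
rewrite (nth_pairmap x) ?size_rcons // (nth_map x) //.
rewrite next_nth mem_nth // index_uniq //; congr [set _; _].
- by rewrite -rcons_cons nth_rcons /= ltis.
(* For the last edge [i = size s], and the default value [x] of [nth] is the first vertex, to which
   the cycle returns. *)
- rewrite nth_rcons; case: ltngtP => // h; first by rewrite ltnNge -ltnS ltis in h.
  by rewrite h nth_default.
Qed.

Lemma cycle_edges_rot i c : uniq c -> cycle_edges (rot i c) = cycle_edges c.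
Proof.
move=> u; rewrite /cycle_edges; apply/setP=> g.
apply/imsetP/imsetP => -[y]; rewrite ?mem_rot => yc ->; exists y;
  by rewrite ?mem_rot ?next_rot.
Qed.

(* Opening the cycle at [f]: its other edges form a path joining the two ends
   of [f]. *)
Lemma cycle_edge_open E C f : is_cycle E C -> f \in C ->
  exists x y s, [/\ f = [set x; y], path (adj (E :\ f)) y s, last y s = x,
    uniq (f :: path_edges y s) & C = [set g in f :: path_edges y s]].
Proof.
move=> [c [szc /andP [cycc uc] ->]] /imsetP [x xc ef].
(* Rotated to start at [x], the cycle continues with its successor [y], and the remaining edges lead
   from [y] round to [x]. *)
have [i s es] := rot_to xc.
have := cycle_edges_rot i uc; have := next_rot i uc x; have := rot_cycle i (adj E) c.
have := rot_uniq i c; have := size_rot i c; rewrite es uc cycc.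
case: s es => [|y s] es szs us; first by rewrite -szs in szc.
rewrite /= eqxx => /andP [xy pys] ynx eC; rewrite -ynx in ef.
exists x, y, (rcons s x).
have [xys yus] := andP us.
(* The cycle has at least three distinct vertices: the first edge after [y] misses [x], and all
   later ones miss [y]. *)
have fN : f \notin path_edges y (rcons s x).
  case: s {es xy ynx eC pys yus} szs us xys => [|z s] szs us xys.
    by rewrite -szs in szc.
  rewrite ef /= inE negb_or; apply/andP; split.
    apply/eqP=> /setP /(_ x); rewrite !inE eqxx /=.
    by move: xys; rewrite !inE !negb_or => /and3P [/negbTE -> /negbTE ->].
  apply/negP=> /mem_path_edges/(_ (set22 x y)).
  rewrite -rcons_cons mem_rcons inE => h.
  move: us => /=; rewrite !inE !negb_or.
  case/and3P => /andP [/negbTE xNy _] /andP[yz ys _].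
  by move: h; rewrite eq_sym xNy inE (negbTE yz) (negbTE ys).
split=> //.
- rewrite path_adjE; apply/allP=> g gp; rewrite !inE.
  rewrite path_adjE in pys; rewrite [g \in E](allP pys _ gp) andbT.
  by apply: contraNneq fN => <-.
- by rewrite last_rcons.
- rewrite /= fN; apply: uniq_path_edges.
  by rewrite -rcons_cons rcons_uniq xys.
- by rewrite -eC cycle_edgesE // ef.
Qed.

Lemma is_cycle_sub E E' C : E \subset E' -> is_cycle E C -> is_cycle E' C.
Proof.
move=> /subsetP sEE' [c [szc /andP [cycc uc] ->]]; exists c; split=> //.
rewrite /ucycle uc andbT; apply: sub_cycle cycc => x y; exact: sEE'.
Qed.

Lemma cycle_edges_sub E c : ucycle (adj E) c -> cycle_edges c \subset E.
Proof.
case: c => [|x s].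
  by move=> _; apply/subsetP => g /imsetP [].
move=> /andP [cycc uc]; apply/subsetP => g; rewrite cycle_edgesE // inE.
by move: cycc; rewrite /= path_adjE => /allP; apply.
Qed.

Lemma cover_cycle_edges c : uniq c -> cover (cycle_edges c) = [set x in c].
Proof.
case: c => [|x s] us.
  by apply/setP=> y; rewrite inE; apply/bigcupP => -[g /imsetP []].
apply/setP=> y; rewrite inE; apply/bigcupP/idP.
- move=> [g]; rewrite cycle_edgesE // inE => /mem_path_edges h /h.
  by rewrite -rcons_cons mem_rcons !inE orbA orbb.
- by move=> ys; exists [set y; next (x :: s) y]; [apply: imset_f | apply: set21].
Qed.

Lemma is_cycleD1 E C f : is_cycle E C -> f \notin C -> is_cycle (E :\ f) C.
Proof.
move=> [c [szc uc eC]] fC; exists c; split=> //; move: uc szc eC.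
case: c => // x s /andP [cyc us] _ eC; rewrite /ucycle us andbT.
move: cyc; rewrite /= !path_adjE => /allP cyc; apply/allP => g gs.
rewrite !inE [g \in E]cyc // andbT; apply: contraNneq fC => <-.
by rewrite eC cycle_edgesE // inE.
Qed.

Lemma cover_cycle_connect E C x y : is_cycle E C ->
  x \in cover C -> y \in cover C -> connect (adj E) x y.
Proof.
move=> [[|a s] [szc /andP [/= cyc us] ->]] //.
rewrite cover_cycle_edges // !in_set => xs ys.
have h z : z \in a :: s -> connect (adj E) a z.
  move=> zs; apply: (path_connect cyc).
  by rewrite -rcons_cons mem_rcons inE zs orbT.
apply: connect_trans (h _ ys); rewrite connect_adj_sym; exact: h.
Qed.

(** A path without repetition that joins the ends of [f] and avoids [f] is closed to a cycle by
    [f]. *)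
Lemma cycle_of_connectD1 E f a b : a != b -> f = [set a; b] -> f \in E ->
  connect (adj (E :\ f)) a b -> exists2 C, is_cycle E C & f \in C.
Proof.
move=> nab ef fE /connectP [p0 /shortenP [p pp up _] eb].
have edge_last : [set last a p; a] = f by rewrite -eb ef setUC.
exists (cycle_edges (a :: p)); last first.
  by rewrite cycle_edgesE // inE path_edges_rcons edge_last mem_rcons mem_head.
exists (a :: p); split=> //.
(* An empty path would give [a = b], and a path with a single edge would use [f] itself. *)
- case: p pp eb {up edge_last} => [|y [|z p]] //=.
    by move=> _ eb; rewrite eb eqxx in nab.
  rewrite /adj /= !inE => /andP[/andP [h _] _] eb.
  by rewrite ef eb eqxx in h.
- rewrite /ucycle up andbT /= path_adjE path_edges_rcons edge_last all_rcons.
  rewrite /= fE /=; move: pp; rewrite path_adjE; apply: sub_all => g.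
  by rewrite /= !inE => /andP [].
Qed.

(** Follow the walk until it is about to use [f] for the first time: it then stands at an end of
    [f]. If it never uses [f], its last vertex [z] will do. *)
Lemma connect_endpoint E f x z : connect (adj E) x z -> z \in f ->
  exists2 y, y \in f & connect (adj (E :\ f)) x y.
Proof.
move=> /connectP [p + ->]; elim: p x => [|y p IH] x /=; first by exists x.
move=> /andP [xy pp] lf.
have [exy|nxy] := eqVneq [set x; y] f; first by exists x; rewrite // -exy set21.
have [w wf cyw] := IH y pp lf; exists w => //.
by apply: connect_trans cyw; apply: connect1; rewrite /adj /= !inE nxy.
Qed.

Lemma component_connect E (A : {pred 'I_n}) x y : connect (adj E) x y ->
  (x \in component E A) = (y \in component E A).
Proof.
move=> cxy; rewrite !inE; apply/existsP/existsP => -[z /andP [zA cz]]; exists z.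
  by rewrite zA (connect_trans cz).
by rewrite zA (connect_trans cz) // connect_adj_sym.
Qed.

Lemma path_to_exists E x y (A : {pred 'I_n}) : connect (adj E) x y -> y \in A ->
  exists p : n.-bseq 'I_n, path_to E x A p.
Proof.
move=> /connectP [p0 /shortenP [p pp up _] ->] lA.
have szp : (size p <= n)%N.
  have /card_uniqP <- : uniq p by case/andP: up.
  by rewrite -[X in (_ <= X)%N]card_ord max_card.
by exists (Bseq szp); apply/and3P; split.
Qed.

Lemma the_pathP E x y (A : {pred 'I_n}) : connect (adj E) x y -> y \in A ->
  path_to E x A (the_path E x A).
Proof.
move=> cxy yA; rewrite /the_path; case: pickP => // h.
by have [p] := path_to_exists cxy yA; rewrite h.
Qed.

Lemma the_shortest_pathP E x y (A : {pred 'I_n}) :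
  connect (adj E) x y -> y \in A -> path_to E x A (the_shortest_path E x A).
Proof.
move=> cxy yA; rewrite /the_shortest_path; case: pickP => [p /andP [] //|h].
have [p0 pp0] := path_to_exists cxy yA.
(* Some path has least length, so the default value [[::]] is never taken. *)
case: (@arg_minnP _ p0 (fun p : n.-bseq 'I_n => path_to E x A p)
  (fun r => size r) pp0) => p pp min.
have := h p; rewrite /shortest_path_to pp /= => /negP [].
by apply/forallP => q; apply/implyP; apply: min.
Qed.

End Walks.

(** * Signs of walks and of cycles *)

Section Signs.
Variables (n : nat) (G : signedGraph n).
Implicit Types (E C : {set {set 'I_n}}) (f g : {set 'I_n}) (x y z : 'I_n)
  (p q s c : seq 'I_n).

Lemma sign_sq f : f \in edges G -> sign G f * sign G f = 1.
Proof. by move=> /sign_pm1 [] ->. Qed.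

Lemma path_sign_cons x y p :
  path_sign G x (y :: p) = sign G [set x; y] * path_sign G y p.
Proof. by rewrite /path_sign /= big_cons. Qed.

Lemma path_sign_cat x p q :
  path_sign G x (p ++ q) = path_sign G x p * path_sign G (last x p) q.
Proof. by rewrite /path_sign /path_edges pairmap_cat big_cat. Qed.

Lemma path_sign_rev x p :
  path_sign G (last x p) (rev (belast x p)) = path_sign G x p.
Proof.
elim: p x => //= y p IH x; rewrite rev_cons -cats1 path_sign_cat IH.
rewrite [RHS]path_sign_cons mulrC; congr (_ * _).
by rewrite /path_sign /= big_seq1 last_rev_belast setUC.
Qed.

Variables (E : {set {set 'I_n}}) (sEG : E \subset edges G).

Lemma path_sign_sq x p : path (adj E) x p -> path_sign G x p * path_sign G x p = 1.
Proof.
elim: p x => [|y p IH] x /=; first by rewrite /path_sign big_nil.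
move=> /andP [xy /IH h]; rewrite path_sign_cons mulrACA h sign_sq //.
exact: (subsetP sEG).
Qed.

(* A closed walk that repeats a vertex splits into two shorter closed walks;
   one that does not is a cycle, or goes back and forth along an edge. *)
Lemma closed_walk_sign x p : path (adj E) x p -> last x p = x ->
  (forall c, (2 < size c)%N -> ucycle (adj E) c -> ~ {subset c <= p}) ->
  path_sign G x p = 1.
Proof.
have [k] := ubnP (size p); elim: k x p => // k IH x p szp pp lp acyc.
have [up|/not_uniq_split [p1 [z [p2 [p3 ep]]]]] := boolP (uniq p); last first.
  move: pp lp szp acyc; rewrite {p}ep cat_path /= cat_path /= last_cat /=.
  rewrite last_cat /= size_cat /= size_cat /=.
  move=> /and5P [pp1 e1 pp2 e2 pp3] lp szp acyc.
  have sgn1 : path_sign G x (p1 ++ z :: p3) = 1.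
    apply: IH.
    - by rewrite size_cat /=; lia.
    - by rewrite cat_path /= pp1 e1.
    - by rewrite last_cat.
    - move=> c szc uc sc; apply: (acyc c) => // w /sc.
      rewrite !(mem_cat, inE) => /or3P [] -> //; rewrite ?orbT //.
  have sgn2 : path_sign G z (rcons p2 z) = 1.
    apply: IH.
    - by rewrite size_rcons; lia.
    - by rewrite rcons_path pp2.
    - by rewrite last_rcons.
    - move=> c szc uc sc; apply: (acyc c) => // w /sc.
      by rewrite mem_rcons !(mem_cat, inE) => /orP [] ->; rewrite ?orbT.
  move: sgn1; rewrite !path_sign_cat !path_sign_cons -cat_rcons path_sign_cat.
  by rewrite sgn2 last_rcons mul1r.
case: p pp lp acyc up {szp} => [|y p] pp lp acyc up.
  by rewrite /path_sign big_nil.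
have uc : ucycle (adj E) (y :: p) by rewrite /ucycle up (cycle_path x) lp pp.
case: p pp lp acyc up uc => [|z [|w p]] pp lp acyc up uc.
(* A closed walk of length one would be a loop, but edges have two elements. *)
- move: pp lp => /= /andP [xy _] eyx; move: xy; rewrite eyx /adj /=.
  by move=> /(subsetP sEG) /edges_card2; rewrite setUid cards1.
- move: pp lp => /= /and3P [xy _ _] ->; rewrite !path_sign_cons.
  rewrite [path_sign G x [::]]/path_sign big_nil mulr1 [[set y; x]]setUC.
  by rewrite sign_sq //; apply: (subsetP sEG).
- by case: (acyc _ _ uc).
Qed.

(** The walk along [p] and back along [q] is closed, hence of sign 1, and signs of walks square to
    1. Acyclicity is asked of the component of [x] alone: after removal of a bridge, the cycle
    survives in the other component. *)
Lemma path_sign_unique x p q : path (adj E) x p -> path (adj E) x q ->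
  last x p = last x q ->
  (forall c, (2 < size c)%N -> ucycle (adj E) c ->
     ~ {subset c <= connect (adj E) x}) ->
  path_sign G x p = path_sign G x q.
Proof.
move=> pp pq elast acyc.
have pr : path (adj E) x (p ++ rev (belast x q)).
  by rewrite cat_path pp elast path_adj_rev.
have : path_sign G x (p ++ rev (belast x q)) = 1.
  apply: (closed_walk_sign pr).
    by rewrite last_cat elast last_rev_belast.
  move=> c szc uc sc; apply: (acyc c) => // w /sc wp.
  by apply: (path_connect pr); rewrite inE wp orbT.
rewrite path_sign_cat elast path_sign_rev => h.
by rewrite -[RHS]mul1r -h -mulrA path_sign_sq // mulr1.
Qed.

Lemma cycle_sign C : C \subset edges G ->
  \prod_(f in C) sign G f = (-1) ^+ #|[set f in C | negative G f]|.
Proof.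
move=> /subsetP sC; rewrite (bigID (negative G)) /= [X in _ * X]big1 ?mulr1.
  rewrite -prodr_const; apply: eq_big => f; first by rewrite inE.
  by rewrite /negative => /andP [_ /eqP].
move=> f /andP [/sC /sign_pm1 [] // sf].
by rewrite /negative sf.
Qed.


Lemma cycle_sign_open C f x s : C = [set g in f :: path_edges x s] ->
  uniq (f :: path_edges x s) ->
  \prod_(g in C) sign G g = sign G f * path_sign G x s.
Proof.
move=> -> u; rewrite /path_sign -[RHS](big_cons _ _ _ _ predT) big_uniq //=.
by apply: eq_bigl => g; rewrite inE.
Qed.

End Signs.

(** * Columns of the incidence matrix, weights and tails *)

Section InverseEntries.
Variables (R : numFieldType) (n : nat) (G : signedGraph n)
  (C : {set {set 'I_n}}) (e : 'I_n -> {set 'I_n}) (N : 'M[R]_n).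
Hypotheses (unbG : unbalanced_unicyclic G) (cycC : is_cycle (edges G) C)
  (enum_e : edge_enumeration G e) (incN : incidence_matrix G e N).
Implicit Types (i l : 'I_n) (x y z : 'I_n).

Local Notation M := (inverse_entry G e N C).

Lemma edge_mem l : e l \in edges G.
Proof. by case: enum_e => _ <-; apply: imset_f. Qed.

Lemma edge_ends l : exists a b, a != b /\ e l = [set a; b].
Proof. by apply/cards2P; rewrite (edges_card2 (edge_mem l)). Qed.

Lemma cycle_unique C' : is_cycle (edges G) C' -> C' = C.
Proof. by case: unbG => -[_ [C0 [_ u]]] _ h; rewrite -(u _ h) -(u _ cycC). Qed.

Lemma cycle_sign_C : \prod_(f in C) sign G f = -1.
Proof.
rewrite cycle_sign; last first.
  by case: cycC => c [_ uc ->]; apply: cycle_edges_sub.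
by case: unbG => _ /(_ _ cycC); rewrite /unbalanced_cycle -signr_odd => ->.
Qed.

Lemma incidence_sq l x : x \in e l -> N x l * N x l = 1.
Proof.
move=> xl; have [a [b [nab el]]] := edge_ends l.
have [_ /(_ a b nab el) [ha hb _ _]] := incN l.
move: xl; rewrite el !inE => /orP [] /eqP ->.
  by case: ha => ->; rewrite ?mulrNN mulr1.
by case: hb => ->; rewrite ?mulrNN mulr1.
Qed.

Lemma incidence_pm1 l x : x \in e l -> N x l = 1 \/ N x l = -1.
Proof.
by move=> /incidence_sq/eqP; rewrite -expr2 sqrf_eq1 => /orP [] /eqP; [left|right].
Qed.

(** One formula for both signs of the edge: each entry of the column determines the other. *)
Lemma incidence_ends l a b : a != b -> e l = [set a; b] ->
  N b l = - ((sign G (e l))%:~R * N a l).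
Proof.
move=> nab el; have [_ /(_ a b nab el) [_ _ hn hp]] := incN l.
have [s1|s1] := sign_pm1 (edge_mem l); rewrite s1.
  by rewrite mul1r hp ?opprK // /positive s1.
by rewrite mulN1r opprK hn // /negative s1.
Qed.

Lemma mul_incidence (A : 'M[R]_n) i l a b : a != b -> e l = [set a; b] ->
  (A *m N) i l = N a l * (A i a - (sign G (e l))%:~R * A i b).
Proof.
move=> nab el; rewrite mxE (bigD1 a) //= (bigD1 b) 1?eq_sym //= big1 ?addr0.
  rewrite (incidence_ends nab el) mulrBr mulrN [N a l * A i a]mulrC.
  by rewrite mulrA [A i b * _]mulrC -mulrA [A i b * _]mulrC mulrCA.
move=> j /andP [ja jb]; have [-> //] := incN l; first by rewrite mulr0.
by rewrite el !inE negb_or ja.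
Qed.

(** On a negative edge the two entries agree, so the weight is their common value. *)
Lemma weight_incidence l x : x \in e l ->
  edge_weight G e N l = if positive G (e l) then 1 else N x l.
Proof.
move=> xl; have [a [b [nab el]]] := edge_ends l.
have Nb := incidence_ends nab el.
rewrite /edge_weight /positive /negative; have [s1|s1] := sign_pm1 (edge_mem l).
  by rewrite s1.
rewrite s1 mulN1r opprK in Nb; rewrite s1 eqxx /=.
have Nx y : y \in e l -> N y l = N a l.
  by rewrite el !inE => /orP [] /eqP ->.
rewrite (Nx x xl); case: ifP => [/forallP /(_ a)|].
  by rewrite el set21 => /eqP.
case: (@incidence_pm1 l a) => [|-> //|Na]; first by rewrite el set21.
move/negP; case; apply/forallP=> y; apply/implyP => /Nx ->; exact/eqP.
Qed.

Lemma oppr1_neq1 : (-1 == 1 :> R) = false.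
Proof. by rewrite -subr_eq0 -opprD oppr_eq0 (pnatr_eq0 R 2). Qed.

(** A positive edge has opposite entries, so exactly one of them is 1; on a negative edge the tail
    is the smaller end. The form [=i pred1 t] records that the tail is unique. *)
Lemma tail_exists l : exists t h,
  [/\ t != h, e l = [set t; h] & is_tail G e N l =i pred1 t].
Proof.
have [a [b [nab el]]] := edge_ends l; have nba : b != a by rewrite eq_sym.
have elC : e l = [set b; a] by rewrite el setUC.
have Nb := incidence_ends nab el.
have n1 := oppr1_neq1.
have [s1|s1] := sign_pm1 (edge_mem l).
  rewrite s1 mul1r in Nb.
  have [|Na|Na] := @incidence_pm1 l a; first by rewrite el set21.
    exists a, b; split=> // y; rewrite !inE /positive s1 eqxx el !inE.
    have [->|/=] := eqVneq y a; first by rewrite Na eqxx.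
    by have [->|//] := eqVneq y b; rewrite Nb Na n1.
  exists b, a; split=> // y; rewrite !inE /positive s1 eqxx el !inE.
  have [->|] := eqVneq y b; first by rewrite Nb Na opprK eqxx orbT.
  by have [->|//] := eqVneq y a; rewrite Na n1.
have tail_lt (u v : 'I_n) : (u < v)%N -> e l = [set u; v] -> is_tail G e N l =i pred1 u.
  move=> uv euv y; rewrite !inE /positive s1 /= euv !inE.
  apply/andP/eqP => [[yuv /forallP /(_ u)]|->].
    rewrite set21 /=; case/orP: yuv => /eqP -> //; by rewrite leqNgt uv.
  split; first by rewrite eqxx.
  by apply/forallP=> w; apply/implyP; rewrite !inE => /orP [] /eqP ->; rewrite // ltnW.
case: (ltngtP a b) => [ab|ba|/val_inj ab]; last by rewrite ab eqxx in nab.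
  by exists a, b; split=> //; apply: tail_lt ab el.
by exists b, a; split=> //; apply: tail_lt ba elC.
Qed.

Lemma sgn_path_unique i x p q :
  (forall c, (2 < size c)%N -> ucycle (adj (edges G :\ e i)) c ->
     ~ {subset c <= connect (adj (edges G :\ e i)) x}) ->
  path (adj (edges G :\ e i)) x p -> path (adj (edges G :\ e i)) x q ->
  last x p = last x q -> path_sign G x p = path_sign G x q.
Proof.
by move=> acyc pp pq el; apply: path_sign_unique el acyc; rewrite ?subD1set.
Qed.

Lemma adj_other i l a b : i != l -> e l = [set a; b] ->
  adj (edges G :\ e i) a b.
Proof.
move=> nil el; rewrite /adj /= -el !inE edge_mem andbT.
by case: enum_e => inj _; rewrite (inj_eq inj) eq_sym.
Qed.

(** * Rows of the edges on the cycle *)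

Section CycleEdge.
Variables (i : 'I_n) (iC : e i \in C).
Local Notation E' := (edges G :\ e i).

(** A cycle avoiding [e i] is also a cycle of the whole graph, hence equal to [C], which contains
    [e i]. *)
Lemma cycle_edge_acyclic c : (2 < size c)%N -> ucycle (adj E') c -> False.
Proof.
move=> szc uc; have := cycle_edges_sub uc.
have -> : cycle_edges c = C.
  by apply: cycle_unique; apply: (@is_cycle_sub _ E'); [apply: subD1set | exists c].
by move/subsetP/(_ _ iC); rewrite !inE eqxx.
Qed.

(** Each vertex reaches an end of [e i] without using [e i], and the rest of the cycle joins the two
    ends. *)
Lemma cycle_edge_connected x y : connect (adj E') x y.
Proof.
have [u [v [s [ei pvs lvs _ _]]]] := cycle_edge_open cycC iC.
have cvu : connect (adj E') v u by apply/connectP; exists s.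
have ends w w' : w \in e i -> w' \in e i -> connect (adj E') w w'.
  have eiE z : (z \in e i) = (z == u) || (z == v) by rewrite ei in_set2.
  rewrite !eiE => /orP [] /eqP -> /orP [] /eqP -> //.
  by rewrite connect_adj_sym.
have [[conG _] _] := unbG.
have ui : u \in e i by rewrite ei set21.
have [z zi cxz] := connect_endpoint (conG x u) ui.
have [w wi cyw] := connect_endpoint (conG y u) ui.
apply: connect_trans cxz _; apply: connect_trans (ends _ _ zi wi) _.
by rewrite connect_adj_sym.
Qed.

(** The sign can be read off any walk to the tail, even one that repeats vertices, because the
    remaining graph is a tree. *)
Lemma sgn_path_tailE t x p : is_tail G e N i =i pred1 t ->
  path (adj E') x p -> last x p = t -> sgn_path_tail G e N i x = path_sign G x p.
Proof.
move=> it pp lp; have ti : t \in is_tail G e N i by rewrite it inE.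
have /and3P [pq _ lq] := the_pathP (cycle_edge_connected x t) ti.
apply: (sgn_path_unique _ pq pp); first by move=> c szc /(cycle_edge_acyclic szc).
by rewrite lp; move: lq; rewrite it => /eqP.
Qed.

Lemma inverse_row_cycle_edge l :
  (\matrix_(r, j) M r j *m N) i l = (i == l)%:R.
Proof.
have [t [h [nth eth it]]] := tail_exists i.
have [eil|nil] := eqVneq i l; last first.
  have [a [b [nab el]]] := edge_ends l.
  rewrite (mul_incidence _ _ nab el) !mxE /inverse_entry iC.
  have ti : t \in is_tail G e N i by rewrite it inE.
  have /and3P [pb _ lb] := the_pathP (cycle_edge_connected b t) ti.
  rewrite it inE in lb.
  rewrite (sgn_path_tailE it pb (eqP lb)).
  (* Prefixing [a] to the path from [b] may revisit [a], but a walk suffices. The entries at [a] and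
     [b] thus differ by the factor [sign G (e l)] and cancel. *)
  have pa : path (adj E') a (b :: the_path E' b (is_tail G e N i)).
    by rewrite /= pb (adj_other nil el).
  rewrite (sgn_path_tailE it pa (eqP lb)) path_sign_cons -el intrM.
  by rewrite [2^-1 * (_ * _)]mulrCA [_ * (_%:~R * _)]mulrCA subrr mulr0.
(* With the tail [t] as first end, the path from [t] to the tail is empty and has sign 1. *)
rewrite -{l}eil (mul_incidence _ _ nth eth) !mxE /inverse_entry iC.
rewrite (sgn_path_tailE it (p := [::])) // {1}/path_sign big_nil.
have [u [v [s [ei pvs lvs us eC]]]] := cycle_edge_open cycC iC.
have sC := cycle_sign_open G eC us; rewrite cycle_sign_C in sC.
(* The cycle opened at [e i] joins head and tail, and its sign times that of [e i] is the sign -1 of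
   [C]. It runs from [v] to [u]; when [v] is the tail it is read backwards. *)
have sh : sign G (e i) * sgn_path_tail G e N i h = -1.
  rewrite sC; congr (_ * _).
  have [vh|vt] := eqVneq v h.
    rewrite -vh; apply: (sgn_path_tailE it pvs); rewrite lvs.
    have : t \in e i by rewrite eth set21.
    by rewrite ei vh in_set2 (negbTE nth) orbF => /eqP.
  have ev : v = t.
    have : v \in e i by rewrite ei set22.
    by rewrite eth in_set2 (negbTE vt) orbF => /eqP.
  have eu : last v s = h.
    have : h \in e i by rewrite eth set22.
    by rewrite lvs ei ev in_set2 [h == t]eq_sym (negbTE nth) orbF => /eqP.
  rewrite -path_sign_rev -eu; apply: (sgn_path_tailE it).
    by rewrite path_adj_rev.
  by rewrite last_rev_belast.
have ti : t \in e i by rewrite eth set21.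
rewrite 2![(sign G (e i))%:~R * _]mulrCA -intrM sh.
rewrite -mulrBr (weight_incidence ti) mulrA.
(* The weight cancels the entry at the tail: both are 1 on a positive edge, and they are equal on a
   negative one. *)
have -> : N t i * (if positive G (e i) then 1 else N t i) = 1.
  have [pos|_] := boolP (positive G (e i)); last exact: incidence_sq.
  have : t \in is_tail G e N i by rewrite it inE.
  by rewrite inE pos mulr1 => /andP [_ /eqP].
(* What is left is half of [1 - (-1)]. *)
by rewrite mul1r -mulrBr opprK mulVf // pnatr_eq0.
Qed.

End CycleEdge.

(** * Rows of the edges outside the cycle, which are bridges *)

Section Bridge.
Variables (i : 'I_n) (iC : e i \notin C).
Local Notation E' := (edges G :\ e i).
Local Notation K := (cycle_component G e C i).

Lemma cover_sub_cycle_component x : x \in cover C -> x \in K.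
Proof. by move=> xC; rewrite inE; apply/existsP; exists x; rewrite xC connect0. Qed.

(** Both vertices are connected to the cycle, which stays intact because [e i] is not one of its
    edges. *)
Lemma cycle_component_connect x y : x \in K -> y \in K -> connect (adj E') x y.
Proof.
rewrite !inE => /existsP [u /andP [uC cux]] /existsP [v /andP [vC cvy]].
apply: connect_trans cvy; rewrite connect_adj_sym in cux.
apply: connect_trans cux _.
by apply: cover_cycle_connect uC vC; apply: is_cycleD1.
Qed.

(** Such a cycle would be [C], whose vertices lie in [K], and a walk from [x] to one of them would
    put [x] in [K]. *)
Lemma bridge_outside_acyclic x : x \notin K ->
  forall c, (2 < size c)%N -> ucycle (adj E') c ->
  ~ {subset c <= connect (adj E') x}.
Proof.
move=> xK c szc uc sc; have /andP [_ unc] := uc.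
have eC : cycle_edges c = C.
  by apply: cycle_unique; apply: (@is_cycle_sub _ E'); [apply: subD1set | exists c].
case: c szc sc {uc} unc eC => [|a c] // _ sc unc eC.
have aK : a \in K.
  apply: cover_sub_cycle_component.
  by rewrite -eC cover_cycle_edges // inE mem_head.
by rewrite (component_connect _ (sc a (mem_head _ _))) aK in xK.
Qed.

(** If both ends were in [K], they would be connected without [e i], giving a cycle through [e i]
    and so different from [C]. A walk from [C] towards [e i] shows that one end is in [K]. *)
Lemma bridge_endsP : exists u v,
  [/\ u != v, e i = [set u; v], u \notin K & v \in K].
Proof.
have [a [b [nab ei]]] := edge_ends i.
have nboth : ~~ ((a \in K) && (b \in K)).
  apply/negP=> /andP [aK bK].
  have cab := cycle_component_connect aK bK.
  have [C' cC' iC'] := cycle_of_connectD1 nab ei (edge_mem i) cab.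
  by rewrite (cycle_unique cC') (negbTE iC) in iC'.
have [x xC] : exists x, x \in cover C.
  have [[|x c] [szc /andP [_ uc] ->]] // := cycC.
  by exists x; rewrite cover_cycle_edges // inE mem_head.
have [[conG _] _] := unbG.
have ai : a \in e i by rewrite ei set21.
have [y yi cxy] := connect_endpoint (conG x a) ai.
have yK : y \in K by rewrite -(component_connect _ cxy) cover_sub_cycle_component.
move: yi yK; rewrite ei !in_set2 => /orP [] /eqP -> yK; rewrite yK ?andbT /= in nboth.
  by exists b, a; rewrite eq_sym setUC.
by exists a, b.
Qed.

(** From outside [K] the end [v] cannot be reached without [e i], so the shortest path to [e i]
    stops at [u]; its sign is that of any walk to [u]. *)
Lemma sgn_path_edgeE u v x p : e i = [set u; v] -> v \in K -> x \notin K ->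
  path (adj E') x p -> last x p = u -> sgn_path_edge G e i x = path_sign G x p.
Proof.
move=> ei vK xK pp lp; have ui : u \in e i by rewrite ei set21.
have cxu : connect (adj E') x u by apply/connectP; exists p.
have /and3P [pq _ lq] := the_shortest_pathP (A := mem (e i)) cxu ui.
apply: (sgn_path_unique (bridge_outside_acyclic xK) pq pp).
have eiE z : (z \in e i) = (z == u) || (z == v) by rewrite ei in_set2.
rewrite lp; move: lq; rewrite [_ \in _]eiE => /orP [] /eqP // lv.
have cxv : connect (adj E') x v by apply/connectP; eexists; last exact/esym/lv.
by rewrite (component_connect _ cxv) vK in xK.
Qed.

Lemma inverse_row_bridge l :
  (\matrix_(r, j) M r j *m N) i l = (i == l)%:R.
Proof.
have [u [v [nuv ei uK vK]]] := bridge_endsP.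
have ui : u \in e i by rewrite ei set21.
have [eil|nil] := eqVneq i l.
  rewrite -{l}eil (mul_incidence _ _ nuv ei) !mxE /inverse_entry (negbTE iC).
  (* The entry at [v] is 0, and the path from [u] to [e i] is empty. *)
  rewrite vK (negbTE uK) !mulr0 subr0.
  rewrite (sgn_path_edgeE ei vK uK (p := [::])) // /path_sign big_nil.
  rewrite (weight_incidence ui).
  have [pos|] := boolP (positive G (e i)); last by rewrite mulr1 incidence_sq.
  have Nv := incidence_ends nuv ei; rewrite (eqP pos) mul1r in Nv.
  rewrite mul1r /= !inE.
  (* On a positive edge, [N u i = 1] makes [v] the head, so [u] is outside the head component;
     [N u i = -1] makes [u] the head. The sign in the entry matches [N u i] in both cases. *)
  have [Nu|Nu] := incidence_pm1 ui.
    rewrite ifN ?Nu ?mulr1 //; apply/negP => /existsP [h /andP [hh chu]].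
    move: hh; rewrite inE pos => /andP []; rewrite ei in_set2.
    case/orP => /eqP eh; rewrite eh in chu *.
      by rewrite Nu eq_sym oppr1_neq1.
    by rewrite -(component_connect _ chu) vK in uK.
  rewrite ifT ?Nu ?mulrNN ?mulr1 //; apply/existsP; exists u.
  by rewrite connect0 andbT inE ui pos Nu eqxx.
have [a [b [nab el]]] := edge_ends l.
have adjab := adj_other nil el; have cab := connect1 adjab.
rewrite (mul_incidence _ _ nab el) !mxE /inverse_entry (negbTE iC).
(* The ends of [e l] stay connected without [e i], so the same case of the formula applies to
   both. *)
rewrite (component_connect _ cab : (a \in K) = (b \in K)).
rewrite (component_connect _ cab : (a \in head_component G e N i) = _).
have [bK|bK] := boolP (b \in K); first by rewrite !mulr0 subrr mulr0.
have aK : a \notin K by rewrite (component_connect _ cab).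
have [[conG _] _] := unbG.
have [w wi /connectP [p pb lw]] := connect_endpoint (conG b u) ui.
(* The walk from [b] cannot arrive at [v], which lies in [K]. *)
have wu : w = u.
  move: wi; rewrite ei in_set2 => /orP [] /eqP // wv.
  have cbv : connect (adj E') b v by apply/connectP; exists p; rewrite -?wv.
  by rewrite (component_connect _ cbv) vK in bK.
rewrite wu in lw.
rewrite (sgn_path_edgeE ei vK bK pb) //.
rewrite (sgn_path_edgeE ei vK aK (p := b :: p)) //= ?adjab //.
rewrite path_sign_cons -el intrM.
by case: ifP => _; rewrite [_ * (edge_weight _ _ _ _ * _)]mulrCA ?mulrN subrr mulr0.
Qed.

End Bridge.
End InverseEntries.

(** * From the rows of the product to the inverse matrix *)

Theorem theorem3p5 (R : numFieldType) (n : nat) (G : signedGraph n)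
    (C : {set {set 'I_n}}) (e : 'I_n -> {set 'I_n}) (N : 'M[R]_n)
    (unbG : unbalanced_unicyclic G) (cycC : is_cycle (edges G) C)
    (enum_e : edge_enumeration G e) (incN : incidence_matrix G e N) :
  N \in unitmx /\
  forall i j : 'I_n, (invmx N) i j = inverse_entry G e N C i j.
Proof.
have MN1 : \matrix_(i, j) inverse_entry G e N C i j *m N = 1%:M.
  apply/matrixP=> i l; rewrite [RHS]mxE.
  have [iC|iC] := boolP (e i \in C).
    exact: (inverse_row_cycle_edge unbG cycC enum_e incN iC).
  exact: (inverse_row_bridge unbG cycC enum_e incN iC).
(* For square matrices a left inverse already gives invertibility. *)
have [_ uN] := mulmx1_unit MN1; split=> // i j.
by rewrite -[invmx N]mul1mx -MN1 mulmxK // mxE.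
Qed.
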